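(* Let $\alpha_0,\dots,\alpha_5$ be complex parameters with $2\alpha_0+\alpha_1+\alpha_2+\alpha_3+\alpha_4+\alpha_5\neq0$. There exist two Hamiltonians $H_1,H_2$, polynomial in $(q_1,p_1,q_2,p_2)$ with coefficients rational in $(t,s)$, such that the Hamiltonian system $$dq_i=\frac{\partial H_1}{\partial p_i}dt+\frac{\partial H_2}{\partial p_i}ds,\qquad dp_i=-\frac{\partial H_1}{\partial q_i}dt-\frac{\partial H_2}{\partial q_i}ds\qquad(i=1,2)$$ is transformed into a polynomial Hamiltonian system under each of the following birational and symplectic transformations $r_i:(q_1,p_1,q_2,p_2)\mapsto(x_i,y_i,z_i,w_i)$, $i=0,\dots,5$: $$\begin{aligned} r_0:&\ \left(\tfrac1{q_1},-(p_1q_1+p_2q_2+\alpha_0)q_1,\tfrac{q_2}{q_1},p_2q_1\right),\\ r_1:&\ \left(q_1,p_1,-((q_2-1)p_2-\alpha_1)p_2,\tfrac1{p_2}\right),\\ r_2:&\ \left(q_1,p_1,-(q_2p_2-\alpha_2)p_2,\tfrac1{p_2}\right),\\ r_3:&\ \left(-((q_1-q_2)p_1-\alpha_3)p_1,\tfrac1{p_1},q_2,p_2+p_1\right),\\ r_4:&\ \left(-((q_1-s)p_1-\alpha_4)p_1,\tfrac1{p_1},q_2,p_2\right),\\ r_5:&\ \left(-((q_1-t)p_1-\alpha_5)p_1,\tfrac1{p_1},q_2,p_2\right). \end{aligned}$$ These Hamiltonians are given by $$\begin{aligned} &(t-s)(t-1)t(2\alpha_0+\alpha_1+\alpha_2+\alpha_3+\alpha_4+\alpha_5)H_1\\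 &=(t-1)\{(q_1-s)(q_1-t)q_1p_1^2+\alpha_0(\alpha_0+\alpha_1)q_1+p_1((t-1)(q_1(\alpha_3+\alpha_4)-s\alpha_3)\\ &\quad+(2\alpha_0+\alpha_1)(q_1-s)q_1+\alpha_2(q_1-s)(q_1-1)+\alpha_3(q_1-s)-\alpha_4(s-1)q_1)\}\\ &\quad-s\{(q_2-t)(q_2-1)q_2p_2^2+\alpha_0(\alpha_0+\alpha_4)q_2+p_2(2\alpha_0(q_2-1)q_2+\alpha_1(t-1)q_2\\ &\quad+\alpha_2t(q_2-1)+\alpha_4(q_2-1)q_2)\}\\ &\quad+(q_1-s)(q_1-t)^2p_1^2q_2+q_1p_2^2(q_2-t)(q_2-1)q_2+\alpha_0(\alpha_0q_1q_2+\alpha_2tq_1+\alpha_4tq_2)\\ &\quad+p_1(2p_2(q_1-s)(q_1-t)(q_2-1)q_2+2\alpha_0(q_1-s)(q_1-t)q_2+\alpha_2(q_1-s)(q_1-1)\\ &\quad+\alpha_4(t-s)(q_1-t)q_2)\\ &\quad+p_2(2\alpha_0q_1(q_2-1)q_2+\alpha_1(t-1)q_1q_2+\alpha_2tq_1(q_2-1)+\alpha_4t(q_2-1)q_2), \end{aligned}$$ and $H_2=\pi(H_1)$, where $\pi$ is the substitution exchanging $t\leftrightarrow s$ and $\alpha_4\leftrightarrow\alpha_5$.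
   Context: Being transformed into a polynomial Hamiltonian system under $r_i$ means that, in the coordinates $(x_i,y_i,z_i,w_i)$, the system is again Hamiltonian with Hamiltonians polynomial in $(x_i,y_i,z_i,w_i)$. Concretely, $H_1$ and $H_2$ rewritten in the new coordinates are polynomial (coefficients rational in $t,s$), except that, because $r_5$ depends on $t$ and $r_4$ depends on $s$, for $r_5$ the polynomial requirement on the first Hamiltonian is that $H_1-p_1$ is polynomial in $(x_5,y_5,z_5,w_5)$, and for $r_4$ the requirement on the second Hamiltonian is that $H_2-p_1$ is polynomial in $(x_4,y_4,z_4,w_4)$. *)

(* Defs.v *)
From mathcomp Require Import all_boot all_order all_algebra.
From mathcomp Require Import reals.
From mathcomp Require Import complex.
From mathcomp Require Import mpoly.

Set Implicit Arguments.
Unset Strict Implicit.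
Unset Printing Implicit Defensive.

Import GRing.Theory.
Local Open Scope ring_scope.
Local Open Scope quotient_scope.

(* C(t,s), then C(t,s)[q1,p1,q2,p2], then C(t,s)(q1,p1,q2,p2).  In {mpoly C[2]}
   variable 0 is t and variable 1 is s; the four canonical coordinates are
   always listed in the order (q1,p1,q2,p2), resp. (x,y,z,w). *)
Notation timeField C := {fraction {mpoly C[2]}}.
Notation phasePoly C := {mpoly (timeField C)[4]}.
Notation phaseField C := {fraction (phasePoly C)}.

Definition i_t : 'I_2 := @Ordinal 2 0 isT.
Definition i_s : 'I_2 := @Ordinal 2 1 isT.
Definition i_q1 : 'I_4 := @Ordinal 4 0 isT.
Definition i_p1 : 'I_4 := @Ordinal 4 1 isT.
Definition i_q2 : 'I_4 := @Ordinal 4 2 isT.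
Definition i_p2 : 'I_4 := @Ordinal 4 3 isT.

Definition coords4 (A : Type) (a b c d : A) (j : 'I_4) : A :=
  tnth [tuple a; b; c; d] j.

Definition timeVar (C : fieldType) (k : 'I_2) : timeField C :=
  tofrac ('X_k : {mpoly C[2]}).
Definition timeCst (C : fieldType) (a : C) : timeField C :=
  tofrac (a%:MP : {mpoly C[2]}).

Definition polyCst (C : fieldType) (c : timeField C) : phasePoly C := c%:MP.
Definition fracCst (C : fieldType) (c : timeField C) : phaseField C :=
  tofrac (polyCst c).
Definition polyVar (C : fieldType) (j : 'I_4) : phasePoly C := 'X_j.
Definition fracVar (C : fieldType) (j : 'I_4) : phaseField C :=
  tofrac (polyVar C j).

(* P(v_0,v_1,v_2,v_3): substitution of rational functions in a polynomial *)
Definition psubst (C : fieldType) (P : phasePoly C) (v : 'I_4 -> phaseField C) :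
    phaseField C :=
  mmap (@fracCst C) v P.

(* Quotient rule; when d is a derivation of A this is its unique extension to
   the fraction field, whatever representative repr returns. *)
Definition fracDeriv (A : idomainType) (d : A -> A) (f : {fraction A}) :
    {fraction A} :=
  let n := \n_(repr f) in
  let m := \d_(repr f) in
  tofrac (d n * m - n * d m) / tofrac m ^+ 2.

Definition phaseDeriv (C : fieldType) (j : 'I_4) :
    phaseField C -> phaseField C :=
  fracDeriv (mderiv j).

(* d/dt (k = i_t) or d/ds (k = i_s) at fixed (q1,p1,q2,p2) *)
Definition timeDeriv (C : fieldType) (k : 'I_2) :
    phaseField C -> phaseField C :=
  fracDeriv (map_mpoly (fracDeriv (mderiv k)) : phasePoly C -> phasePoly C).

(* (dH/dp1, -dH/dq1, dH/dp2, -dH/dq2) *)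
Definition hamField (C : fieldType) (H : phasePoly C) : 'I_4 -> phasePoly C :=
  coords4 (mderiv i_p1 H) (- mderiv i_q1 H) (mderiv i_p2 H) (- mderiv i_q2 H).

(* Coefficient of dt (k = i_t) or ds (k = i_s) in df, for f a rational function of
   (t,s,q1,p1,q2,p2), along the Hamiltonian system whose Hamiltonian for the
   time k is H. *)
Definition flowDeriv (C : fieldType) (k : 'I_2) (H : phasePoly C)
    (f : phaseField C) : phaseField C :=
  timeDeriv k f + \sum_(j < 4) tofrac (hamField H j) * phaseDeriv j f.

(* In the coordinates r = (x,y,z,w), the system with Hamiltonians (H1, H2) is
   the Hamiltonian system with polynomial Hamiltonians (K1, K2); K1 and K2 are
   H1 and H2 rewritten in the new coordinates, up to the corrections e1 and e2
   which account for the dependence of r on t and s. *)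
Definition polyHamiltonianIn (C : fieldType) (H1 H2 : phasePoly C)
    (e1 e2 : phaseField C) (r : 'I_4 -> phaseField C) : Prop :=
  exists K1 K2 : phasePoly C,
    [/\ psubst K1 r = tofrac H1 - e1,
        psubst K2 r = tofrac H2 - e2,
        forall j, flowDeriv i_t H1 (r j) = psubst (hamField K1 j) r
      & forall j, flowDeriv i_s H2 (r j) = psubst (hamField K2 j) r].

(* The rational function f can be evaluated at v, with value y. *)
Definition ratValue (C : fieldType) (f : phaseField C)
    (v : 'I_4 -> phaseField C) (y : phaseField C) : Prop :=
  exists n d : phasePoly C,
    [/\ f = tofrac n / tofrac d, psubst d v != 0 & y = psubst n v / psubst d v].

Definition birational (C : fieldType) (r : 'I_4 -> phaseField C) : Prop :=
  exists g : 'I_4 -> phaseField C,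
    forall j, ratValue (g j) r (fracVar C j) /\ ratValue (r j) g (fracVar C j).

(* Matrix of the 2-form dq1 /\ dp1 + dq2 /\ dp2. *)
Definition omega (F : fieldType) : 'M[F]_4 :=
  \matrix_(j, k) ((~~ odd j && (k == j.+1 :> nat))%:R
                  - (~~ odd k && (j == k.+1 :> nat))%:R).

Definition jacobian (C : fieldType) (r : 'I_4 -> phaseField C) :
    'M[phaseField C]_4 :=
  \matrix_(j, k) phaseDeriv k (r j).

(* dx /\ dy + dz /\ dw = dq1 /\ dp1 + dq2 /\ dp2, with t and s fixed. *)
Definition symplectic (C : fieldType) (r : 'I_4 -> phaseField C) : Prop :=
  (jacobian r)^T *m omega _ *m jacobian r = omega _.

Definition rmap (F : fieldType) (t s a0 a1 a2 a3 a4 a5 q1 p1 q2 p2 : F)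
    (i : 'I_6) : 'I_4 -> F :=
  tnth [tuple
    coords4 (1 / q1) (- (p1 * q1 + p2 * q2 + a0) * q1) (q2 / q1) (p2 * q1);
    coords4 q1 p1 (- ((q2 - 1) * p2 - a1) * p2) (1 / p2);
    coords4 q1 p1 (- (q2 * p2 - a2) * p2) (1 / p2);
    coords4 (- ((q1 - q2) * p1 - a3) * p1) (1 / p1) q2 (p2 + p1);
    coords4 (- ((q1 - s) * p1 - a4) * p1) (1 / p1) q2 p2;
    coords4 (- ((q1 - t) * p1 - a5) * p1) (1 / p1) q2 p2] i.

(* The equation defining H1 is H1factor * H1 = H1rhs. *)
Definition H1factor (A : comNzRingType) (t s a0 a1 a2 a3 a4 a5 : A) : A :=
  (t - s) * (t - 1) * t * (2 * a0 + a1 + a2 + a3 + a4 + a5).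

Definition H1rhs (A : comNzRingType) (q1 p1 q2 p2 : A)
    (t s a0 a1 a2 a3 a4 a5 : A) : A :=
  (t - 1) *
    ((q1 - s) * (q1 - t) * q1 * p1 ^+ 2 + a0 * (a0 + a1) * q1
     + p1 * ((t - 1) * (q1 * (a3 + a4) - s * a3)
             + (2 * a0 + a1) * (q1 - s) * q1
             + a2 * (q1 - s) * (q1 - 1)
             + a3 * (q1 - s)
             - a4 * (s - 1) * q1))
  - s *
    ((q2 - t) * (q2 - 1) * q2 * p2 ^+ 2 + a0 * (a0 + a4) * q2
     + p2 * (2 * a0 * (q2 - 1) * q2
             + a1 * (t - 1) * q2
             + a2 * t * (q2 - 1)
             + a4 * (q2 - 1) * q2))
  + (q1 - s) * (q1 - t) ^+ 2 * p1 ^+ 2 * q2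
  + q1 * p2 ^+ 2 * (q2 - t) * (q2 - 1) * q2
  + a0 * (a0 * q1 * q2 + a2 * t * q1 + a4 * t * q2)
  + p1 * (2 * p2 * (q1 - s) * (q1 - t) * (q2 - 1) * q2
          + 2 * a0 * (q1 - s) * (q1 - t) * q2
          + a2 * (q1 - s) * (q1 - 1)
          + a4 * (t - s) * (q1 - t) * q2)
  + p2 * (2 * a0 * q1 * (q2 - 1) * q2
          + a1 * (t - 1) * q1 * q2
          + a2 * t * q1 * (q2 - 1)
          + a4 * t * (q2 - 1) * q2).

(* The substitution t <-> s, a4 <-> a5 in an expression f in t, s, a0, ..., a5. *)
Definition piSubst (A X : Type) (f : A -> A -> A -> A -> A -> A -> A -> A -> X)
    (t s a0 a1 a2 a3 a4 a5 : A) : X :=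
  f s t a0 a1 a2 a3 a5 a4.

(* f(t, s, a0, ..., a5) for the actual t and s and complex values of the a_i,
   all read in a ring containing C(t,s) through emb. *)
Definition atParams (C : fieldType) (A X : Type) (emb : timeField C -> A)
    (f : A -> A -> A -> A -> A -> A -> A -> A -> X)
    (a0 a1 a2 a3 a4 a5 : C) : X :=
  f (emb (timeVar C i_t)) (emb (timeVar C i_s))
    (emb (timeCst a0)) (emb (timeCst a1)) (emb (timeCst a2))
    (emb (timeCst a3)) (emb (timeCst a4)) (emb (timeCst a5)).

(* Main.v *)
Require Import Defs.
From HB Require Import structures.
From mathcomp Require Import all_boot all_order all_algebra.
From mathcomp Require Import reals.
From mathcomp Require Import complex.
From mathcomp Require Import mpoly.
From mathcomp Require Import ring.

Set Implicit Arguments.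
Unset Strict Implicit.
Unset Printing Implicit Defensive.

Import GRing.Theory.
Local Open Scope ring_scope.

(** The Hamiltonians are forced: each is the displayed right-hand side divided
by its factor, which does not vanish because 2 a0 + a1 + ... + a5 is nonzero.
Three facts then remain for each coordinate change r.

Symplecticity and birationality.  All maps but r_0 have the shape
x = - ((q - c) p - a) p, y = 1/p on one canonical pair, so dx /\ dy =
d(q - c) /\ dp, and q = c + (a - x y) y inverts them; r_0 is an involution.
Instead of computing Jacobians, the identity of 2-forms is checked on an
arbitrary pair of derivations ([rmap_area]).

Polynomiality.  In such coordinates u = (q - c) p = a - x y and q = c + y u are
polynomial while p = 1/y is not.  H1 is quadratic in p and its leading
coefficient is divisible by q - c; hence, if (q - c) A(q) p^2 + B(q) p are its
nonconstant terms, the only obstruction to polynomiality is the simple pole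
(a A(c) + B(c)) p ([pole_residue]).  This residue is zero for r_1, ..., r_4 and
equals the factor of H1 for r_5, which is why exactly p1 must be subtracted
from H1 there.  For r_0 the variables q have weight 1 and p weight -1; the part
of H1 of positive weight is a polynomial in y = - (p1 q1 + p2 q2 + a0) q1,
z = q2/q1 and elements of weight 0 ([H1rhs_regular0]).  The symmetry pi permutes
r_4 and r_5 and fixes the other maps, so it transports all this to H2.

Equations of motion.  If r is symplectic with Jacobian J and J^T Omega J =
Omega, then J Omega J^T = Omega too, and the chain rule gives that r carries the
field of H to that of K, up to the contribution of the explicit time dependence
of r and of the correction H - K.  Since the Hamiltonian field of p1 is d/dq1,
these two cancel as soon as d/dt + d/dq1 kills the components of r
([hamiltonian_transport]): r_5 involves q1 and t through q1 - t only, and r_4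
likewise involves q1 and s through q1 - s only. *)

Local Notation "x %:F" := (tofrac x).

(** * Derivations and their extension to fractions *)

Definition derivation (A : comNzRingType) (D : A -> A) : Prop :=
  (forall x y, D (x + y) = D x + D y) /\
  (forall x y, D (x * y) = D x * y + x * D y).

Section Derivation.
Variables (A : comNzRingType) (D : A -> A) (dD : derivation D).

Lemma derivationD x y : D (x + y) = D x + D y. Proof. exact: dD.1. Qed.
Lemma derivationM x y : D (x * y) = D x * y + x * D y. Proof. exact: dD.2. Qed.
Lemma derivation0 : D 0 = 0.
Proof. by apply: (addIr (D 0)); rewrite -derivationD !add0r. Qed.
Lemma derivation1 : D 1 = 0.
Proof.
by apply: (addrI (D 1)); rewrite addr0 -{3}[1]mulr1 derivationM mulr1 mul1r.
Qed.
Lemma derivationN x : D (- x) = - D x.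
Proof. by apply: (addIr (D x)); rewrite -derivationD !addNr derivation0. Qed.
Lemma derivationB x y : D (x - y) = D x - D y.
Proof. by rewrite derivationD derivationN. Qed.
Lemma derivation_sum I (s : seq I) (P : pred I) (f : I -> A) :
  D (\sum_(i <- s | P i) f i) = \sum_(i <- s | P i) D (f i).
Proof. exact: (big_morph D derivationD derivation0). Qed.

End Derivation.

Lemma derivationV (F : fieldType) (D : F -> F) (dD : derivation D) x :
  D x^-1 = - (D x / x ^+ 2).
Proof.
have [->|x0] := eqVneq x 0.
  by rewrite invr0 (derivation0 dD) mul0r oppr0.
have : D (x * x^-1) = 0 by rewrite divff ?(derivation1 dD).
rewrite (derivationM dD) => e; apply: (mulfI x0).
by rewrite -[LHS](addKr (D x / x)) e; field.
Qed.

Lemma derivation_add (A : comNzRingType) (D D' : A -> A) (b : A) :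
  derivation D -> derivation D' -> derivation (fun x => D x + b * D' x).
Proof.
move=> dD dD'; split=> x y; first by rewrite (derivationD dD) (derivationD dD'); ring.
by rewrite (derivationM dD) (derivationM dD'); ring.
Qed.

(** The definition of [fracDeriv] reads off an arbitrary representative; this is
what relates it to the fraction itself. *)
Lemma tofrac_repr (A : idomainType) (f : {fraction A}) :
  f = (\n_(repr f))%:F / (\d_(repr f))%:F.
Proof.
have d0 := denom_ratioP (repr f).
apply: (mulIf (x := (\d_(repr f))%:F)); first by rewrite tofrac_eq0.
rewrite divfK ?tofrac_eq0 //.
rewrite -{1}[f]reprK; unlock tofrac; rewrite -[LHS]FracField.pi_mul.
apply/eqmodP; rewrite /= FracField.equivfE /FracField.mulf /=.
by rewrite !numden_Ratio ?(oner_neq0, mulf_neq0, mulr1, mul1r) // mulrC.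
Qed.

(* The next two identities are stated over an abstract field: normalizing them
   directly in a field of fractions makes conversion unfold its operations. *)
Lemma quotient_rule_add (F : fieldType) (a b c e da db dc de : F) :
  b != 0 -> e != 0 ->
  ((da * e + a * de + (dc * b + c * db)) * (b * e)
   - (a * e + c * b) * (db * e + b * de)) / (b * e) ^+ 2
  = (da * b - a * db) / b ^+ 2 + (dc * e - c * de) / e ^+ 2.
Proof. by move=> b0 e0; field; rewrite b0 e0. Qed.

Lemma quotient_rule_mul (F : fieldType) (a b c e da db dc de : F) :
  b != 0 -> e != 0 ->
  ((da * c + a * dc) * (b * e) - a * c * (db * e + b * de)) / (b * e) ^+ 2
  = (da * b - a * db) / b ^+ 2 * (c / e) + a / b * ((dc * e - c * de) / e ^+ 2).
Proof. by move=> b0 e0; field; rewrite b0 e0. Qed.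

Section FracDeriv.
Variables (A : idomainType) (d : A -> A) (dd : derivation d).

(** The quotient rule does not depend on the representative: differentiate the
cross-multiplied equality of two representatives. *)
Lemma fracDeriv_div n m : m != 0 ->
  fracDeriv d (n%:F / m%:F) = (d n * m - n * d m)%:F / m%:F ^+ 2.
Proof.
move=> m0; rewrite /fracDeriv; set f := n%:F / m%:F.
move: (denom_ratioP (repr f)) (tofrac_repr f).
move: (\n_(repr f)) (\d_(repr f)) => n' m' m'0; rewrite {}/f => e.
move/eqP: e; rewrite eqr_div ?tofrac_eq0 // -!tofracM tofrac_eq => /eqP cross.
have dcross : d n * m' + n * d m' = d n' * m + n' * d m.
  by rewrite -!(derivationM dd) cross.
apply/eqP; rewrite eqr_div ?expf_neq0 ?tofrac_eq0 // -!tofracXn -!tofracM tofrac_eq.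
apply/eqP.
(* m m' times the derivative of n m' = n' m, rearranged *)
have -> : (d n' * m' - n' * d m') * m ^+ 2
    = (d n' * m + n' * d m) * m * m' - (n' * m) * (d m * m' + m * d m') by ring.
by rewrite -dcross -cross; ring.
Qed.

Lemma fracDeriv_tofrac a : fracDeriv d a%:F = (d a)%:F.
Proof.
have := fracDeriv_div a (oner_neq0 A); rewrite tofrac1 divr1 => ->.
by rewrite (derivation1 dd) mulr0 subr0 mulr1 expr1n divr1.
Qed.

Lemma fracDeriv_derivation : derivation (fracDeriv d).
Proof.
split=> x y; rewrite (tofrac_repr x) (tofrac_repr y);
  move: (denom_ratioP (repr x)) (denom_ratioP (repr y));
  move: (\n_(repr x)) (\d_(repr x)) (\n_(repr y)) (\d_(repr y)) => a b c e b0 e0.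
- have -> : a%:F / b%:F + c%:F / e%:F = (a * e + c * b)%:F / (b * e)%:F.
    by rewrite addf_div ?tofrac_eq0 // tofracD !tofracM.
  rewrite !fracDeriv_div ?mulf_neq0 // !(derivationM dd, derivationD dd).
  rewrite !(tofracB, tofracD, tofracM).
  by apply: quotient_rule_add; rewrite tofrac_eq0.
- have -> : a%:F / b%:F * (c%:F / e%:F) = (a * c)%:F / (b * e)%:F.
    by rewrite mulf_div !tofracM.
  rewrite !fracDeriv_div ?mulf_neq0 // !(derivationM dd).
  rewrite !(tofracB, tofracD, tofracM).
  by apply: quotient_rule_mul; rewrite tofrac_eq0.
Qed.

End FracDeriv.

(** * The phase field: chain rule and partial derivatives *)

Lemma mpoly_ring_ind n (R : comNzRingType) (P : {mpoly R[n]} -> Prop) :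
  (forall c, P c%:MP) -> (forall i, P 'X_i) ->
  (forall p q, P p -> P q -> P (p + q)) ->
  (forall p q, P p -> P q -> P (p * q)) -> forall p, P p.
Proof.
move=> PC PX PD PM; elim/mpolyind => [|c m p _ _ Pp]; first by rewrite -mpolyC0.
apply: (PD) => //; rewrite -mul_mpolyC; apply: (PM) => //.
rewrite mpolyXE_id; elim/big_ind: _ => [|p1 p2|i _].
- by rewrite -mpolyC1.
- exact: PM.
- elim: (m i) => [|k IHk]; first by rewrite expr0 -mpolyC1.
  by rewrite exprS; apply: PM.
Qed.

(** Bundled, so that the lemmas on [map_mpoly] of an additive map apply. *)
Definition derivation_additive (R : comNzRingType) (f : R -> R)
    (df : derivation f) : {additive R -> R} :=
  HB.pack_for {additive R -> R} f
    (GRing.isZmodMorphism.Build R R f (derivationB df)).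

Lemma mcoeff_map_derivation n (R : comNzRingType) (f : R -> R)
    (p : {mpoly R[n]}) m :
  derivation f -> (map_mpoly f p)@_m = f p@_m.
Proof. by move=> df; exact: (mcoeff_map_mpoly (derivation_additive df)). Qed.

(** The Leibniz rule is checked coefficientwise, on the convolution formula. *)
Lemma map_mpoly_derivation n (R : comNzRingType) (f : R -> R) :
  derivation f -> derivation (map_mpoly f : {mpoly R[n]} -> {mpoly R[n]}).
Proof.
move=> df.
have E := fun p m => mcoeff_map_derivation (n := n) p m df.
split=> p q; apply/mpolyP => m.
  by rewrite mcoeffD !E mcoeffD (derivationD df).
rewrite mcoeffD E !mcoeffM (derivation_sum df) -big_split /=.
by apply: eq_bigr => k _; rewrite (derivationM df) !E.
Qed.

Lemma mderiv_derivation n (R : comNzRingType) (i : 'I_n) :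
  derivation (mderiv i : {mpoly R[n]} -> {mpoly R[n]}).
Proof. by split; [exact: mderivD | exact: mderivM]. Qed.

Lemma mderiv_var n (R : comNzRingType) (i j : 'I_n) :
  mderiv i ('X_j : {mpoly R[n]}) = (j == i)%:R.
Proof.
rewrite mderivX mnm1E; case: eqP => [->|_]; last by rewrite scale0r.
by rewrite scale1r -{1}[U_(i)%MM]add0m addmK mpolyX0.
Qed.

Section PhaseSpace.
Variable C : fieldType.
Implicit Types (P K H : phasePoly C) (v r : 'I_4 -> phaseField C).

HB.instance Definition _ := GRing.RMorphism.copy (@polyCst C) (@mpolyC 4 _).
HB.instance Definition _ :=
  GRing.RMorphism.copy (@fracCst C) (@tofrac (phasePoly C) \o @polyCst C).
HB.instance Definition _ :=
  GRing.RMorphism.copy (@timeCst C) (@tofrac {mpoly C[2]} \o @mpolyC 2 _).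

Lemma psubstC c v : psubst (polyCst c) v = fracCst c.
Proof. exact: mmapC. Qed.
Lemma psubstX j v : psubst (polyVar C j) v = v j.
Proof. by rewrite /psubst /polyVar mmapX mmap1U. Qed.
Lemma psubstD P K v : psubst (P + K) v = psubst P v + psubst K v.
Proof. exact: mmapD. Qed.
Lemma psubstN P v : psubst (- P) v = - psubst P v.
Proof. exact: mmapN. Qed.
Lemma psubstM P K v : psubst (P * K) v = psubst P v * psubst K v.
Proof. exact: rmorphM. Qed.

Lemma deriv_psubst (D : phaseField C -> phaseField C) K v :
    derivation D -> (forall c, D (fracCst c) = 0) ->
  D (psubst K v) = \sum_(j < 4) psubst (mderiv j K) v * D (v j).
Proof.
move=> dD Dc; elim/mpoly_ring_ind: K => [c|i|P Q IP IQ|P Q IP IQ].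
- rewrite psubstC Dc big1 // => j _.
  by rewrite mderivC /psubst mmap0 mul0r.
- rewrite psubstX (bigD1 i) //= big1 ?addr0 => [|j ji].
    by rewrite mderiv_var eqxx /psubst rmorph1 mul1r.
  by rewrite mderiv_var eq_sym (negbTE ji) /psubst mmap0 mul0r.
- rewrite psubstD (derivationD dD) IP IQ -big_split; apply: eq_bigr => j _ /=.
  by rewrite mderivD psubstD mulrDl.
- rewrite psubstM (derivationM dD) IP IQ mulr_suml mulr_sumr -big_split.
  apply: eq_bigr => j _ /=; rewrite mderivM psubstD !psubstM mulrDl.
  by congr (_ + _); rewrite ?mulrA // mulrAC.
Qed.

Lemma phaseDeriv_derivation j : derivation (@phaseDeriv C j).
Proof. exact/fracDeriv_derivation/mderiv_derivation. Qed.

Lemma phaseDeriv_tofrac j P : @phaseDeriv C j P%:F = (mderiv j P)%:F.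
Proof. exact/fracDeriv_tofrac/mderiv_derivation. Qed.

Lemma phaseDeriv_cst j c : @phaseDeriv C j (fracCst c) = 0.
Proof. by rewrite phaseDeriv_tofrac mderivC tofrac0. Qed.

Lemma phaseDeriv_var j l : @phaseDeriv C j (fracVar C l) = (l == j)%:R.
Proof.
by rewrite phaseDeriv_tofrac mderiv_var rmorph_nat.
Qed.

Lemma timeFieldDeriv_derivation k :
  derivation (fracDeriv (mderiv k) : timeField C -> timeField C).
Proof. exact/fracDeriv_derivation/mderiv_derivation. Qed.

Lemma timeDeriv_derivation k : derivation (@timeDeriv C k).
Proof.
exact/fracDeriv_derivation/map_mpoly_derivation/timeFieldDeriv_derivation.
Qed.

Lemma timeDeriv_tofrac k P :
  timeDeriv k P%:F = (map_mpoly (fracDeriv (mderiv k)) P)%:F.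
Proof.
exact/fracDeriv_tofrac/map_mpoly_derivation/timeFieldDeriv_derivation.
Qed.

Lemma timeDeriv_fracCst k (c : timeField C) :
  @timeDeriv C k (fracCst c) = fracCst (fracDeriv (mderiv k) c).
Proof.
rewrite timeDeriv_tofrac.
have e := map_mpolyC 4 (derivation_additive (timeFieldDeriv_derivation k)) c.
exact: (congr1 (@tofrac (phasePoly C)) e).
Qed.

Lemma timeDeriv_cst k a : @timeDeriv C k (fracCst (timeCst a : timeField C)) = 0.
Proof.
rewrite timeDeriv_fracCst (fracDeriv_tofrac (mderiv_derivation _ k)) mderivC.
by rewrite tofrac0 rmorph0.
Qed.

Lemma timeDeriv_time k l :
  @timeDeriv C k (fracCst (timeVar C l)) = (l == k)%:R.
Proof.
rewrite timeDeriv_fracCst (fracDeriv_tofrac (mderiv_derivation _ k)).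
by rewrite mderiv_var rmorph_nat -(rmorph_nat (@fracCst C)).
Qed.

Lemma timeDeriv_var k l : @timeDeriv C k (fracVar C l) = 0.
Proof.
rewrite timeDeriv_tofrac -[RHS]tofrac0; congr tofrac; apply/mpolyP => m.
rewrite (mcoeff_map_derivation _ _ (timeFieldDeriv_derivation k)) mcoeff0 mcoeffX.
by case: eqP => _; [exact/derivation1/timeFieldDeriv_derivation
                   |exact/derivation0/timeFieldDeriv_derivation].
Qed.

End PhaseSpace.

(** * Transport of Hamiltonian systems *)

Lemma forall_coord (P : 'I_4 -> Prop) :
  P i_q1 -> P i_p1 -> P i_q2 -> P i_p2 -> forall j, P j.
Proof.
move=> P0 P1 P2 P3 [[|[|[|[|//]]]] lt4];
  [move: P0|move: P1|move: P2|move: P3]; congr P; exact: val_inj.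
Qed.

Lemma sum_coord (V : nmodType) (f : 'I_4 -> V) :
  \sum_(j < 4) f j = f i_q1 + f i_p1 + f i_q2 + f i_p2.
Proof.
rewrite !big_ord_recl big_ord0 addr0 !addrA.
by do !congr (_ + _); congr f; exact: val_inj.
Qed.

Lemma omega_mulE (F : fieldType) (f : 'I_4 -> F) :
  omega F *m \col_j f j = \col_j coords4 (f i_p1) (- f i_q1) (f i_p2) (- f i_q2) j.
Proof.
apply/colP => j; rewrite !mxE sum_coord !mxE /=.
by elim/forall_coord: j; rewrite /coords4 (tnth_nth 0) /=; ring.
Qed.

Lemma omega_sqr (F : fieldType) : omega F *m omega F = - 1%:M.
Proof.
apply/matrixP => i j; rewrite !mxE sum_coord !mxE.
by elim/forall_coord: i; elim/forall_coord: j => /=; ring.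
Qed.

(** The matrices of a symplectic group are closed under transposition: since
Omega^2 = -1, the hypothesis exhibits - Omega J^T Omega as a left inverse of J,
hence also as a right inverse. *)
Lemma symplectic_transpose (F : fieldType) (J : 'M[F]_4) :
  J^T *m omega F *m J = omega F -> J *m omega F *m J^T = omega F.
Proof.
move=> sJ.
have /mulmx1C JV : - (omega F *m J^T *m omega F) *m J = 1%:M.
  by rewrite mulNmx -!mulmxA [J^T *m _]mulmxA sJ omega_sqr opprK.
have : J *m - (omega F *m J^T *m omega F) *m omega F = omega F.
  by rewrite JV mul1mx.
by rewrite mulmxN mulNmx -!mulmxA omega_sqr !mulmxN mulmx1 opprK mulmxA.
Qed.

(** The Hamiltonian vector field of p1 is d/dq1. *)
Lemma omega_momentum (F : fieldType) (J : 'M[F]_4) (b : bool) :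
  J *m omega F *m (\col_j (b && (j == i_p1))%:R) = b%:R *: col i_q1 J.
Proof.
rewrite -mulmxA omega_mulE; apply/colP => j; rewrite !mxE sum_coord !mxE.
by rewrite /coords4 !(tnth_nth 0) /=; case: b; rewrite /=; ring.
Qed.

Section Transport.
Variable C : fieldType.
Implicit Types (P K H : phasePoly C) (r : 'I_4 -> phaseField C).

Lemma hamField_omega (F : fieldType) (f : phasePoly C -> F) H :
    (forall P, f (- P) = - f P) ->
  \col_j f (hamField H j) = omega F *m \col_j f (mderiv j H).
Proof.
move=> fN; rewrite omega_mulE; apply/colP; elim/forall_coord; rewrite !mxE //;
  exact: fN.
Qed.

(** With gradients as columns, grad H = J^T (grad K o r) + grad e for the
correction e, so the velocity of r is dr/dt + J Omega grad H, that is
dr/dt + J Omega J^T (grad K o r) + J Omega grad e.  The middle term is the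
Hamiltonian field of K; the hypothesis on the time derivative says that the two
other terms cancel. *)
Lemma hamiltonian_transport k (b : bool) r K H :
    symplectic r ->
    psubst K r = H%:F - (if b then fracVar C i_p1 else 0) ->
    (forall j, timeDeriv k (r j) + b%:R * phaseDeriv i_q1 (r j) = 0) ->
  forall j, flowDeriv k H (r j) = psubst (hamField K j) r.
Proof.
move=> /symplectic_transpose sr Kr r_t.
set J := jacobian r in sr; pose F := phaseField C.
pose gradK : 'cV[F]_4 := \col_j psubst (mderiv j K) r.
pose gradH : 'cV[F]_4 := \col_j (mderiv j H)%:F.
pose grade : 'cV[F]_4 := \col_j (b && (j == i_p1))%:R.
have eH : gradH = J^T *m gradK + grade.
  apply/colP => j; rewrite !mxE -phaseDeriv_tofrac.
  have -> : H%:F = psubst K r + (if b then fracVar C i_p1 else 0).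
    by rewrite Kr subrK.
  have dj := phaseDeriv_derivation C j.
  rewrite (derivationD dj) (deriv_psubst K r dj (phaseDeriv_cst j)).
  congr (_ + _); first by apply: eq_bigr => l _; rewrite !mxE; exact: mulrC.
  case: b {Kr r_t grade}; last by rewrite (derivation0 dj).
  by rewrite phaseDeriv_var eq_sym.
have eflow : \col_j flowDeriv k H (r j)
    = \col_j timeDeriv k (r j) + J *m omega F *m gradH.
  rewrite -mulmxA -hamField_omega; last exact: tofracN.
  apply/colP => j; rewrite !mxE; congr (_ + _).
  by apply: eq_bigr => l _; rewrite !mxE; exact: mulrC.
have etime : \col_j timeDeriv k (r j) = - (J *m omega F *m grade).
  rewrite omega_momentum; apply/colP => j; rewrite !mxE.
  by rewrite (canRL (addrK _) (r_t j)) sub0r.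
have : \col_j flowDeriv k H (r j) = \col_j psubst (hamField K j) r.
  rewrite (hamField_omega (f := fun P => psubst P r)) => [|P]; last exact: psubstN.
  rewrite eflow etime eH mulmxDr addrCA addNr addr0.
  by rewrite mulmxA sr.
by move=> e j; move/colP/(_ j): e; rewrite !mxE.
Qed.

End Transport.

(** * Polynomiality of the Hamiltonian in the new coordinates *)

(** In the applications S is the set of rational functions that are polynomial in
the new coordinates; the computations below only use that it is a ring. *)
Definition subring (A : nzRingType) (S : A -> Prop) : Prop :=
  [/\ S 1, forall x y, S x -> S y -> S (x - y)
    & forall x y, S x -> S y -> S (x * y)].

Section Subring.
Variables (A : nzRingType) (S : A -> Prop) (hS : subring S).

Lemma subring1 : S 1. Proof. by case: hS. Qed.
Lemma subringM x y : S x -> S y -> S (x * y). Proof. by case: hS => _ _; exact. Qed.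
Lemma subringB x y : S x -> S y -> S (x - y). Proof. by case: hS => _ + _; exact. Qed.
Lemma subring0 : S 0.
Proof. by rewrite -(subrr 1); apply: subringB; exact: subring1. Qed.
Lemma subringN x : S x -> S (- x).
Proof. by move=> Sx; rewrite -sub0r; apply: subringB => //; exact: subring0. Qed.
Lemma subringD x y : S x -> S y -> S (x + y).
Proof. by move=> Sx Sy; rewrite -[y]opprK; apply/subringB/subringN. Qed.
Lemma subring_nat n : S n%:R.
Proof.
elim: n => [|n IHn]; first exact: subring0.
by rewrite -addn1 natrD; apply: subringD => //; exact: subring1.
Qed.
Lemma subringX x n : S x -> S (x ^+ n).
Proof.
move=> Sx; elim: n => [|n IHn]; first exact: subring1.
by rewrite exprS; apply: subringM.
Qed.

End Subring.

Ltac in_subring hS :=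
  first [assumption | lazymatch goal with
  | |- _ (_ + _) => apply: (subringD hS); in_subring hS
  | |- _ (- _) => apply: (subringN hS); in_subring hS
  | |- _ (_ * _) => apply: (subringM hS); in_subring hS
  | |- _ (_ ^+ _) => apply: (subringX hS); in_subring hS
  | |- _ (_ %:R) => exact: (subring_nat hS)
  | |- _ 1 => exact: (subring1 hS)
  | |- _ 0 => exact: (subring0 hS)
  end].

(** A canonical pair (q, p) is replaced by x = - ((q - c) p - a) p and y = 1/p,
both in S. *)
Section PoleCoordinates.
Variables (F : fieldType) (S : F -> Prop) (hS : subring S).
Variables (q p c a : F).
Hypotheses (p0 : p != 0) (Sc : S c) (Sa : S a).
Hypotheses (Sx : S (- ((q - c) * p - a) * p)) (Sy : S (1 / p)).

Lemma pole_u : S ((q - c) * p).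
Proof.
have -> : (q - c) * p = a - (- ((q - c) * p - a) * p) * (1 / p) by field.
in_subring hS.
Qed.

Lemma pole_q : S q.
Proof.
have Su := pole_u; have -> : q = c + (1 / p) * ((q - c) * p) by field.
in_subring hS.
Qed.

(** Put u = (q - c) p.  All terms but u p A0 and p B0 are polynomials in u with
coefficients in S, and u p = a p - x turns these two into the residue and
- x A0. *)
Lemma pole_residue A0 A1 B0 B1 L :
    S A0 -> S A1 -> S B1 -> S L ->
  S ((q - c) * (A0 + (q - c) * A1) * p ^+ 2 + (B0 + (q - c) * B1) * p + L
     - (a * A0 + B0) * p).
Proof.
move=> SA0 SA1 SB1 SL; have Su := pole_u.
have -> : (q - c) * (A0 + (q - c) * A1) * p ^+ 2 + (B0 + (q - c) * B1) * p + L
     - (a * A0 + B0) * p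
   = - (- ((q - c) * p - a) * p * A0) + ((q - c) * p) ^+ 2 * A1
     + ((q - c) * p) * B1 + L by ring.
in_subring hS.
Qed.

End PoleCoordinates.
Arguments pole_residue [F S] hS [q p c a] p0 Sa Sx Sy A0 A1 B0 B1 L.

Section Hamiltonian.
Variables (F : fieldType) (S : F -> Prop) (hS : subring S).
Variables (q1 p1 q2 p2 : F).
Hypotheses (q1_neq0 : q1 != 0) (p1_neq0 : p1 != 0) (p2_neq0 : p2 != 0).

Section Cases.
Variables (t s a0 a1 a2 a3 a4 a5 : F).
Hypotheses (St : S t) (Ss : S s) (S0 : S a0) (S1 : S a1) (S2 : S a2)
  (S3 : S a3) (S4 : S a4) (S5 : S a5).

Let H q1 p1 q2 p2 := H1rhs q1 p1 q2 p2 t s a0 a1 a2 a3 a4 a5.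

(* The coefficient of the first power of p1 in H *)
Let linP1 q1 q2 p2 :=
  (t - 1) * ((t - 1) * (q1 * (a3 + a4) - s * a3) + (2 * a0 + a1) * (q1 - s) * q1
             + a2 * (q1 - s) * (q1 - 1) + a3 * (q1 - s) - a4 * (s - 1) * q1)
  + 2 * (p2 * (q2 - 1) + a0) * q2 * (q1 - s) * (q1 - t)
  + a2 * (q1 - s) * (q1 - 1) + a4 * (t - s) * (q1 - t) * q2.

(* The divided difference (linP1 q1 - linP1 c) / (q1 - c) *)
Let diffP1 c q1 q2 p2 :=
  (t - 1) * ((t - 1) * (a3 + a4) + (2 * a0 + a1) * (q1 + c - s)
             + a2 * (q1 + c - s - 1) + a3 - a4 * (s - 1))
  + 2 * (p2 * (q2 - 1) + a0) * q2 * (q1 + c - s - t)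
  + a2 * (q1 + c - s - 1) + a4 * (t - s) * q2.

(* The coefficient of the first power of p2 in H; its divided difference in q2
   is diffP2. *)
Let linP2 q1 p1 q2 :=
  2 * p1 * (q1 - s) * (q1 - t) * (q2 - 1) * q2
  + (q1 - s) * (2 * a0 * (q2 - 1) * q2 + a1 * (t - 1) * q2 + a2 * t * (q2 - 1))
  + a4 * (t - s) * (q2 - 1) * q2.

Let diffP2 c q1 p1 q2 :=
  2 * p1 * (q1 - s) * (q1 - t) * (q2 + c - 1)
  + (q1 - s) * (2 * a0 * (q2 + c - 1) + a1 * (t - 1) + a2 * t)
  + a4 * (t - s) * (q2 + c - 1).

Let in_eq (x y : F) : S y -> x = y -> S x. Proof. by move=> Sy ->. Qed.

Ltac residue_identity := rewrite /H /linP1 /diffP1 /linP2 /diffP2 /H1rhs /H1factor; ring.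
Ltac residue_regular := rewrite /H /linP1 /diffP1 /linP2 /diffP2 /H1rhs; in_subring hS.

(** Here the residue a5 A0 + linP1 t is the factor of H1; this is where the
normalization of the Hamiltonian comes from. *)
Lemma H1rhs_regular5 :
    S (- ((q1 - t) * p1 - a5) * p1) -> S (1 / p1) -> S q2 -> S p2 ->
  S (H q1 p1 q2 p2 - H1factor t s a0 a1 a2 a3 a4 a5 * p1).
Proof.
move=> Sx Sy Sz Sw; have Sq := pole_q hS p1_neq0 St S5 Sx Sy.
apply: in_eq (pole_residue hS p1_neq0 S5 Sx Sy ((t - s) * (t - 1) * t)
  ((t - 1) * (q1 + t - s) + (q1 - s) * q2) (linP1 t q2 p2)
  (diffP1 t q1 q2 p2) (H q1 0 q2 p2) _ _ _ _) _;
  last residue_identity.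
all: residue_regular.
Qed.

(** Here a4 A0 + linP1 s = 0, and likewise for the three maps below. *)
Lemma H1rhs_regular4 :
    S (- ((q1 - s) * p1 - a4) * p1) -> S (1 / p1) -> S q2 -> S p2 ->
  S (H q1 p1 q2 p2).
Proof.
move=> Sx Sy Sz Sw; have Sq := pole_q hS p1_neq0 Ss S4 Sx Sy.
apply: in_eq (pole_residue hS p1_neq0 S4 Sx Sy
  ((s - t) * ((t - 1) * s + (s - t) * q2))
  ((t - 1) * (q1 + s - t) + q2 * (q1 + s - 2 * t)) (linP1 s q2 p2)
  (diffP1 s q1 q2 p2) (H q1 0 q2 p2) _ _ _ _) _;
  last residue_identity.
all: residue_regular.
Qed.

(** The pole sits at q1 = q2 and the momentum kept fixed is w = p1 + p2, so H is
first rewritten as a polynomial in p1 and w; the substitution p2 = w - p1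
is what makes the coefficient of p1^2 divisible by q1 - q2. *)
Lemma H1rhs_regular3 :
    S (- ((q1 - q2) * p1 - a3) * p1) -> S (1 / p1) -> S q2 -> S (p2 + p1) ->
  S (H q1 p1 q2 p2).
Proof.
move=> Sx Sy Sz Sw; have Sq := pole_q hS p1_neq0 Sz S3 Sx Sy.
have [w def_w] : exists w, w = p2 + p1 by exists (p2 + p1).
rewrite -def_w in Sw; have {def_w} -> : p2 = w - p1 by rewrite def_w addrK.
apply: in_eq (pole_residue hS p1_neq0 S3 Sx Sy
  (- ((q2 - s) * t * (t - 1)))
  ((q1 - s) * (t - 1 + q2) - t * (t - 1))
  (linP1 q2 q2 w - linP2 q2 w q2)
  (diffP1 q2 q1 q2 w - 2 * w * (q2 - t) * (q2 - 1) * q2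
     - (2 * a0 * (q2 - 1) * q2 + a1 * (t - 1) * q2 + a2 * t * (q2 - 1)))
  (H q1 0 q2 w) _ _ _ _) _;
  last residue_identity.
all: residue_regular.
Qed.

Lemma H1rhs_regular2 :
    S q1 -> S p1 -> S (- (q2 * p2 - a2) * p2) -> S (1 / p2) ->
  S (H q1 p1 q2 p2).
Proof.
move=> Sx Sy; rewrite -{1}[q2]subr0 => Sz Sw.
have S0' := subring0 hS; have Sq := pole_q hS p2_neq0 S0' S2 Sz Sw.
apply: in_eq (pole_residue hS p2_neq0 S2 Sz Sw ((q1 - s) * t)
  ((q1 - s) * (q2 - 1 - t)) (linP2 q1 p1 0) (diffP2 0 q1 p1 q2)
  (H q1 p1 q2 0) _ _ _ _) _;
  last residue_identity.
all: residue_regular.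
Qed.

Lemma H1rhs_regular1 :
    S q1 -> S p1 -> S (- ((q2 - 1) * p2 - a1) * p2) -> S (1 / p2) ->
  S (H q1 p1 q2 p2).
Proof.
move=> Sx Sy Sz Sw.
have S1' := subring1 hS; have Sq := pole_q hS p2_neq0 S1' S1 Sz Sw.
apply: in_eq (pole_residue hS p2_neq0 S1 Sz Sw ((q1 - s) * (1 - t))
  ((q1 - s) * (q2 + 1 - t)) (linP2 q1 p1 1) (diffP2 1 q1 p1 q2)
  (H q1 p1 q2 0) _ _ _ _) _;
  last residue_identity.
all: residue_regular.
Qed.

(** Elements of weight at most 0 are regular: q1 p1 (called P), q2 p2 (called Q),
w = q1 p2, V = q2 p1, as well as p1 and p2.  The part of weight 2 of H is
q1 q2 E^2 with E = p1 q1 + p2 q2 + a0, that is z y^2, and the part of weight 1 is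
divisible by E: it is E (q1 al + q2 be) = - y (al + z be), with al and be of
weight 0.  The rest is Z. *)
Lemma H1rhs_regular0 :
    S (1 / q1) -> S (- (p1 * q1 + p2 * q2 + a0) * q1) -> S (q2 / q1) ->
    S (p2 * q1) ->
  S (H q1 p1 q2 p2).
Proof.
move=> Sx Sy Sz Sw; set x := 1 / q1 in Sx *; set z := q2 / q1 in Sz *.
set w := p2 * q1 in Sw *; set y := - _ * q1 in Sy.
have q2E : q2 = z * q1 by rewrite /z; field.
have p2E : p2 = x * w by rewrite /x /w; field.
have [P defP] : exists P, P = p1 * q1 by exists (p1 * q1).
have [Q defQ] : exists Q, Q = p2 * q2 by exists (p2 * q2).
have QE : Q = z * w by rewrite defQ /z /w; field.
have PE : P = - (x * y) - Q - a0 by rewrite defP defQ /x /y; field.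
have SQ : S Q by rewrite QE; in_subring hS.
have SP : S P by rewrite PE; in_subring hS.
have p1E : p1 = x * P by rewrite /x defP; field.
have Sp2 : S p2 by rewrite p2E; in_subring hS.
have Sp1 : S p1 by rewrite p1E; in_subring hS.
pose V := z * P.
pose Z := (t - 1) * (s * t * P * p1 - (s + t) * P ^+ 2
    + ((t - 1) * ((a3 + a4) * P - s * a3 * p1) - (2 * a0 + a1) * s * P
       + a2 * (s * p1 - (s + 1) * P) + a3 * (P - s * p1) - a4 * (s - 1) * P))
  - s * (t * Q * p2 - (t + 1) * Q ^+ 2
         + (a1 * (t - 1) + a2 * t - 2 * a0 - a4) * Q - a2 * t * p2)
  + V * ((t ^+ 2 + 2 * s * t) * P - s * t ^+ 2 * p1) + t * Q * w
  + 2 * Q * ((s + t) * P + s * t * V - s * t * p1)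
  + 2 * a0 * s * t * V + a2 * (s * p1 - (s + 1) * P) - a4 * t * (t - s) * V
  - a2 * t * w - a4 * t * Q.
pose al := (t - 1) * (P + a0 + a1) + a2 * t - (t + 1) * Q.
pose be := a4 * (t - s) - s * (Q + a0) - (s + 2 * t) * P.
apply: (@in_eq _ (z * y ^+ 2 - y * (al + z * be) + Z)).
  by rewrite /Z /al /be /V; in_subring hS.
rewrite /Z /al /be /H /H1rhs /V /y defP defQ /w /z; field.
exact: q1_neq0.
Qed.

End Cases.
End Hamiltonian.

(** * The six coordinate changes over an arbitrary field *)

Lemma forall_map (P : 'I_6 -> Prop) :
  P (@Ordinal 6 0 isT) -> P (@Ordinal 6 1 isT) -> P (@Ordinal 6 2 isT) ->
  P (@Ordinal 6 3 isT) -> P (@Ordinal 6 4 isT) -> P (@Ordinal 6 5 isT) ->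
  forall i, P i.
Proof.
move=> P0 P1 P2 P3 P4 P5 [[|[|[|[|[|[|//]]]]]] lt6];
  [move: P0|move: P1|move: P2|move: P3|move: P4|move: P5]; congr P; exact: val_inj.
Qed.

(** The only denominator of r_i; as a function of the new coordinates it is also
the only denominator of the inverse, because r_i inverts it. *)
Definition rden (F : fieldType) (q1 p1 p2 : F) (i : 'I_6) : F :=
  match nat_of_ord i with 0 => q1 | 1 => p2 | 2 => p2 | _ => p1 end.

Definition rinv (F : fieldType) (t s a0 a1 a2 a3 a4 a5 x y z w : F)
    (i : 'I_6) : 'I_4 -> F :=
  match nat_of_ord i with
  | 0 => coords4 (1 / x) (- (x * y + z * w + a0) * x) (z / x) (w * x)
  | 1 => coords4 x y (1 + (a1 - z * w) * w) (1 / w)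
  | 2 => coords4 x y ((a2 - z * w) * w) (1 / w)
  | 3 => coords4 (z + (a3 - x * y) * y) (1 / y) z (w - 1 / y)
  | 4 => coords4 (s + (a4 - x * y) * y) (1 / y) z w
  | _ => coords4 (t + (a5 - x * y) * y) (1 / y) z w
  end.

(** Replacing the lookup in a tuple by a match keeps the reductions below cheap. *)
Lemma rmapE (F : fieldType) (t s a0 a1 a2 a3 a4 a5 q1 p1 q2 p2 : F) i :
  rmap t s a0 a1 a2 a3 a4 a5 q1 p1 q2 p2 i =
  match nat_of_ord i with
  | 0 => coords4 (1 / q1) (- (p1 * q1 + p2 * q2 + a0) * q1) (q2 / q1) (p2 * q1)
  | 1 => coords4 q1 p1 (- ((q2 - 1) * p2 - a1) * p2) (1 / p2)
  | 2 => coords4 q1 p1 (- (q2 * p2 - a2) * p2) (1 / p2)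
  | 3 => coords4 (- ((q1 - q2) * p1 - a3) * p1) (1 / p1) q2 (p2 + p1)
  | 4 => coords4 (- ((q1 - s) * p1 - a4) * p1) (1 / p1) q2 p2
  | _ => coords4 (- ((q1 - t) * p1 - a5) * p1) (1 / p1) q2 p2
  end.
Proof. by elim/forall_map: i. Qed.

Lemma coords4E (A : Type) (a b c d : A) j :
  coords4 a b c d j =
  match nat_of_ord j with 0 => a | 1 => b | 2 => c | _ => d end.
Proof. by elim/forall_coord: j. Qed.

Ltac expand_map :=
  rewrite ?rmapE /rinv /rden; cbv iota beta delta [nat_of_ord];
  cbv zeta; rewrite ?rmapE; cbv iota beta delta [nat_of_ord];
  rewrite ?coords4E;
  cbv iota beta delta [nat_of_ord i_q1 i_p1 i_q2 i_p2].

Section Maps.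
Variables (F : fieldType) (t s a0 a1 a2 a3 a4 a5 : F).

Lemma rinvK q1 p1 q2 p2 i j : rden q1 p1 p2 i != 0 ->
  let r := rmap t s a0 a1 a2 a3 a4 a5 q1 p1 q2 p2 i in
  rinv t s a0 a1 a2 a3 a4 a5 (r i_q1) (r i_p1) (r i_q2) (r i_p2) i j
  = coords4 q1 p1 q2 p2 j.
Proof.
elim/forall_map: i; elim/forall_coord: j; expand_map => den0;
  field; rewrite ?den0 ?oner_neq0 ?oppr_eq0 //.
Qed.

Lemma rmapK x y z w i j : rden x y w i != 0 ->
  let g := rinv t s a0 a1 a2 a3 a4 a5 x y z w i in
  rmap t s a0 a1 a2 a3 a4 a5 (g i_q1) (g i_p1) (g i_q2) (g i_p2) i j
  = coords4 x y z w j.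
Proof.
elim/forall_map: i; elim/forall_coord: j; expand_map => den0;
  field; rewrite ?den0 ?oner_neq0 ?oppr_eq0 //.
Qed.

Lemma rden_rmap q1 p1 q2 p2 i : rden q1 p1 p2 i != 0 ->
  let r := rmap t s a0 a1 a2 a3 a4 a5 q1 p1 q2 p2 i in
  rden (r i_q1) (r i_p1) (r i_p2) i != 0.
Proof.
elim/forall_map: i; expand_map => den0; by rewrite div1r invr_eq0.
Qed.

Lemma rden_rinv x y z w i : rden x y w i != 0 ->
  let g := rinv t s a0 a1 a2 a3 a4 a5 x y z w i in
  rden (g i_q1) (g i_p1) (g i_p2) i != 0.
Proof.
elim/forall_map: i; expand_map => den0; by rewrite div1r invr_eq0.
Qed.

(** The value of dq /\ dp on the pair (D, D'). *)
Definition area (D D' : F -> F) (q p : F) := D q * D' p - D' q * D p.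

(** The pair x = - ((q - c) p - a) p, y = 1/p has dx /\ dy = d(q - c) /\ dp; for
r_3, where c = q2, the term - dq2 /\ dp1 is compensated by w = p2 + p1. *)
Lemma rmap_area D D' q1 p1 q2 p2 i :
    derivation D -> derivation D' -> rden q1 p1 p2 i != 0 ->
    (forall c, c \in [:: t; s; a0; a1; a2; a3; a4; a5] -> D c = 0 /\ D' c = 0) ->
  let r := rmap t s a0 a1 a2 a3 a4 a5 q1 p1 q2 p2 i in
  area D D' (r i_q1) (r i_p1) + area D D' (r i_q2) (r i_p2)
  = area D D' q1 p1 + area D D' q2 p2.
Proof.
move=> dD dD' + cst.
have [Dt D't] : D t = 0 /\ D' t = 0 by apply: cst; rewrite !inE eqxx ?orbT.
have [Ds D's] : D s = 0 /\ D' s = 0 by apply: cst; rewrite !inE eqxx ?orbT.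
have [D0 D'0] : D a0 = 0 /\ D' a0 = 0 by apply: cst; rewrite !inE eqxx ?orbT.
have [D1 D'1] : D a1 = 0 /\ D' a1 = 0 by apply: cst; rewrite !inE eqxx ?orbT.
have [D2 D'2] : D a2 = 0 /\ D' a2 = 0 by apply: cst; rewrite !inE eqxx ?orbT.
have [D3 D'3] : D a3 = 0 /\ D' a3 = 0 by apply: cst; rewrite !inE eqxx ?orbT.
have [D4 D'4] : D a4 = 0 /\ D' a4 = 0 by apply: cst; rewrite !inE eqxx ?orbT.
have [D5 D'5] : D a5 = 0 /\ D' a5 = 0 by apply: cst; rewrite !inE eqxx ?orbT.
have E := (derivationD dD, derivationN dD, derivationM dD, derivation1 dD,
  derivationV dD, (Dt, Ds, D0, D1, D2, D3, D4, D5)).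
have E' := (derivationD dD', derivationN dD', derivationM dD', derivation1 dD',
  derivationV dD', (D't, D's, D'0, D'1, D'2, D'3, D'4, D'5)).
elim/forall_map: i; expand_map => den0; rewrite /area !E !E'; field; rewrite ?den0 //.
Qed.

(** The maps r_0, ..., r_3 do not involve t and s, while r_4 and r_5 involve q1 only
through q1 - s and q1 - t. *)
Lemma rmap_ker D q1 p1 q2 p2 i j :
    derivation D -> rden q1 p1 p2 i != 0 ->
    (forall c, c \in [:: a0; a1; a2; a3; a4; a5; p1; q2; p2] -> D c = 0) ->
    D q1 = (if i == 4%N :> nat then D s else if i == 5%N :> nat then D t else 0) ->
  D (rmap t s a0 a1 a2 a3 a4 a5 q1 p1 q2 p2 i j) = 0.
Proof.
move=> dD + cst.
have D0 : D a0 = 0 by apply: cst; rewrite !inE eqxx ?orbT.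
have D1 : D a1 = 0 by apply: cst; rewrite !inE eqxx ?orbT.
have D2 : D a2 = 0 by apply: cst; rewrite !inE eqxx ?orbT.
have D3 : D a3 = 0 by apply: cst; rewrite !inE eqxx ?orbT.
have D4 : D a4 = 0 by apply: cst; rewrite !inE eqxx ?orbT.
have D5 : D a5 = 0 by apply: cst; rewrite !inE eqxx ?orbT.
have Dp1 : D p1 = 0 by apply: cst; rewrite !inE eqxx ?orbT.
have Dq2 : D q2 = 0 by apply: cst; rewrite !inE eqxx ?orbT.
have Dp2 : D p2 = 0 by apply: cst; rewrite !inE eqxx ?orbT.
have E := (derivationD dD, derivationN dD, derivationM dD, derivation1 dD,
  derivationV dD, (D0, D1, D2, D3, D4, D5, Dp1, Dq2, Dp2)).
elim/forall_map: i; elim/forall_coord: j; expand_map => den0 /= Dq1;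
  rewrite ?E ?Dq1; field; rewrite ?den0 //.
Qed.

Lemma H1rhs_regular (S : F -> Prop) q1 p1 q2 p2 i :
    subring S ->
    (forall c, c \in [:: t; s; a0; a1; a2; a3; a4; a5] -> S c) ->
    rden q1 p1 p2 i != 0 ->
    (forall j, S (rmap t s a0 a1 a2 a3 a4 a5 q1 p1 q2 p2 i j)) ->
  S (H1rhs q1 p1 q2 p2 t s a0 a1 a2 a3 a4 a5
     - H1factor t s a0 a1 a2 a3 a4 a5 * (if i == 5%N :> nat then p1 else 0)).
Proof.
move=> hS Sc den0 Sr.
have [St Ss] : S t /\ S s by split; apply: Sc; rewrite !inE eqxx ?orbT.
have [S0 S1] : S a0 /\ S a1 by split; apply: Sc; rewrite !inE eqxx ?orbT.
have [S2 S3] : S a2 /\ S a3 by split; apply: Sc; rewrite !inE eqxx ?orbT.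
have [S4 S5] : S a4 /\ S a5 by split; apply: Sc; rewrite !inE eqxx ?orbT.
move: den0 (Sr i_q1) (Sr i_p1) (Sr i_q2) (Sr i_p2).
elim/forall_map: i {Sr}; expand_map => den0 Sx Sy Sz Sw;
  rewrite /= ?mulr0 ?subr0.
- exact: H1rhs_regular0.
- exact: H1rhs_regular1.
- exact: H1rhs_regular2.
- exact: H1rhs_regular3.
- exact: H1rhs_regular4.
- exact: H1rhs_regular5.
Qed.

End Maps.

(** The relation behaves like the graph of a ring morphism defined on a subring of
F and continued to the fractions whose denominator has a nonzero image, such as
the evaluation of rational functions at a point. *)
Definition partial_morphism (F F' : fieldType) (V : F -> F' -> Prop) : Prop :=
  [/\ V 1 1, forall x x' y y', V x x' -> V y y' -> V (x - y) (x' - y'),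
    forall x x' y y', V x x' -> V y y' -> V (x * y) (x' * y')
    & forall x x', V x x' -> x' != 0 -> V x^-1 x'^-1].

Section Evaluation.
Variables (F F' : fieldType) (V : F -> F' -> Prop) (hV : partial_morphism V).

Lemma eval1 : V 1 1. Proof. by case: hV. Qed.
Lemma evalB x x' y y' : V x x' -> V y y' -> V (x - y) (x' - y').
Proof. by case: hV => _ + _ _; exact. Qed.
Lemma evalM x x' y y' : V x x' -> V y y' -> V (x * y) (x' * y').
Proof. by case: hV => _ _ + _; exact. Qed.
Lemma evalV x x' : V x x' -> x' != 0 -> V x^-1 x'^-1.
Proof. by case: hV => _ _ _; exact. Qed.
Lemma evalN x x' : V x x' -> V (- x) (- x').
Proof.
move=> Vx; rewrite -[- x]sub0r -[- x']sub0r; apply: evalB => //.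
by rewrite -(subrr 1) -[X in V _ X](subrr 1); apply: evalB; exact: eval1.
Qed.
Lemma evalD x x' y y' : V x x' -> V y y' -> V (x + y) (x' + y').
Proof. by move=> Vx Vy; rewrite -[y]opprK -[y']opprK; apply/evalB/evalN. Qed.

Variables (t s a0 a1 a2 a3 a4 a5 q1 p1 q2 p2 : F).
Variables (t' s' a0' a1' a2' a3' a4' a5' q1' p1' q2' p2' : F').
Hypotheses (Vt : V t t') (Vs : V s s') (V0 : V a0 a0') (V1 : V a1 a1')
  (V2 : V a2 a2') (V3 : V a3 a3') (V4 : V a4 a4') (V5 : V a5 a5')
  (Vq1 : V q1 q1') (Vp1 : V p1 p1') (Vq2 : V q2 q2') (Vp2 : V p2 p2').

Ltac evaluate :=
  first [assumption | lazymatch goal with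
  | |- _ (_ + _) _ => apply: evalD; evaluate
  | |- _ (- _) _ => apply: evalN; evaluate
  | |- _ (_ * _) _ => apply: evalM; evaluate
  | |- _ (_ ^-1) _ => apply: evalV; evaluate
  | |- _ 1 _ => exact: eval1
  end].

Lemma rmap_eval i j : rden q1' p1' p2' i != 0 ->
  V (rmap t s a0 a1 a2 a3 a4 a5 q1 p1 q2 p2 i j)
    (rmap t' s' a0' a1' a2' a3' a4' a5' q1' p1' q2' p2' i j).
Proof.
elim/forall_map: i; elim/forall_coord: j; expand_map => den0; evaluate.
Qed.

Lemma rinv_eval i j : rden q1' p1' p2' i != 0 ->
  V (rinv t s a0 a1 a2 a3 a4 a5 q1 p1 q2 p2 i j)
    (rinv t' s' a0' a1' a2' a3' a4' a5' q1' p1' q2' p2' i j).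
Proof.
elim/forall_map: i; elim/forall_coord: j; expand_map => den0; evaluate.
Qed.

End Evaluation.

(** * Back to rational functions on phase space *)

Lemma H1factor_morph (A B : comNzRingType) (f : {rmorphism A -> B})
    t s a0 a1 a2 a3 a4 a5 :
  f (H1factor t s a0 a1 a2 a3 a4 a5)
  = H1factor (f t) (f s) (f a0) (f a1) (f a2) (f a3) (f a4) (f a5).
Proof.
by rewrite /H1factor !(rmorphM, rmorphB, rmorphD, rmorph1, rmorph_nat).
Qed.

Lemma H1rhs_morph (A B : comNzRingType) (f : {rmorphism A -> B})
    q1 p1 q2 p2 t s a0 a1 a2 a3 a4 a5 :
  f (H1rhs q1 p1 q2 p2 t s a0 a1 a2 a3 a4 a5)
  = H1rhs (f q1) (f p1) (f q2) (f p2)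
      (f t) (f s) (f a0) (f a1) (f a2) (f a3) (f a4) (f a5).
Proof.
by rewrite /H1rhs !(rmorphM, rmorphB, rmorphD, rmorphXn, rmorph1, rmorph_nat).
Qed.

(** The entries of J^T Omega J are the values of the 2-form on pairs of columns; this
is what connects [symplectic] to [rmap_area]. *)
Lemma congruence_omega (F : fieldType) (J : 'M[F]_4) j k :
  (J^T *m omega F *m J) j k
  = (J i_q1 j * J i_p1 k - J i_q1 k * J i_p1 j)
    + (J i_q2 j * J i_p2 k - J i_q2 k * J i_p2 j).
Proof. by rewrite !mxE sum_coord !mxE !sum_coord !mxE /=; ring. Qed.

Lemma fraction_sub (F : fieldType) (n d m e : F) :
  d != 0 -> e != 0 -> n / d - m / e = (n * e - m * d) / (d * e).
Proof. by move=> d0 e0; field; rewrite d0 e0. Qed.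

Section Substitution.
Variable C : fieldType.
Implicit Types v r : 'I_4 -> phaseField C.

Lemma psubst1 v : psubst 1 v = 1.
Proof. exact: rmorph1. Qed.

Definition regular r (f : phaseField C) : Prop := exists K, psubst K r = f.

Lemma regular_subring r : subring (regular r).
Proof.
split=> [|x y [K <-] [L <-]|x y [K <-] [L <-]].
- by exists 1; exact: psubst1.
- by exists (K - L); rewrite psubstD psubstN.
- by exists (K * L); rewrite psubstM.
Qed.

Lemma ratValue_tofrac P v : ratValue P%:F v (psubst P v).
Proof.
exists P, 1; rewrite psubst1 tofrac1.
split; [exact/esym/divr1 | exact: oner_neq0 | exact/esym/divr1].
Qed.

Lemma ratValue_partial_morphism v :
  partial_morphism (fun f y => ratValue f v y).
Proof.
have nz d : psubst d v != 0 -> d%:F != 0 :> phaseField C.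
  apply: contra; rewrite tofrac_eq0 => /eqP ->; apply/eqP; exact: mmap0.
split=> [|x x' y y' [n [d [-> d0 ->]]] [m [e [-> e0 ->]]]
         |x x' y y' [n [d [-> d0 ->]]] [m [e [-> e0 ->]]]
         |x x' [n [d [-> d0 ->]]] x0].
- by have := ratValue_tofrac 1 v; rewrite psubst1 tofrac1.
- exists (n * e - m * d), (d * e).
  rewrite psubstD psubstN !psubstM tofracB !tofracM; split.
  - exact: (fraction_sub _ _ (nz _ d0) (nz _ e0)).
  - exact: (mulf_neq0 d0 e0).
  - exact: (fraction_sub _ _ d0 e0).
- exists (n * m), (d * e).
  rewrite !psubstM !tofracM.
  split; [exact: mulf_div | exact: (mulf_neq0 d0 e0) | exact: mulf_div].
- exists d, n; split; [exact: invf_div | | exact: invf_div].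
  by apply: contraNneq x0 => ->; rewrite mul0r.
Qed.

Lemma ratValue_cst c v : ratValue (fracCst c) v (fracCst c).
Proof. by rewrite -{2}(psubstC c v); exact: ratValue_tofrac. Qed.

Lemma ratValue_var j v : ratValue (fracVar C j) v (v j).
Proof. by rewrite -(psubstX j v); exact: ratValue_tofrac. Qed.

Lemma fracVar_neq0 j : fracVar C j != 0.
Proof.
rewrite tofrac_eq0; apply/eqP => /(congr1 (mcoeff U_(j)%MM)).
by rewrite mcoeff0 mcoeffX eqxx => /eqP; rewrite oner_eq0.
Qed.

End Substitution.

Lemma scale_sub (F : fieldType) (k c x y e : F) :
  k * c = 1 -> y = x - c * e -> k * y = k * x - e.
Proof. by move=> kc ->; rewrite mulrBr mulrA kc mul1r. Qed.

Section Assembly.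
Variable C : fieldType.
Local Notation q1 := (fracVar C i_q1).
Local Notation p1 := (fracVar C i_p1).
Local Notation q2 := (fracVar C i_q2).
Local Notation p2 := (fracVar C i_p2).

Lemma fracVar_coords j : coords4 q1 p1 q2 p2 j = fracVar C j.
Proof. by elim/forall_coord: j. Qed.

Lemma rden_fracVar i : rden q1 p1 p2 i != 0.
Proof.
by rewrite /rden; case: (nat_of_ord i) => [|[|[|n]]]; exact: fracVar_neq0.
Qed.

Section Coefficients.
Variables t s a0 a1 a2 a3 a4 a5 : timeField C.

Local Notation inPhase f :=
  (f (fracCst t) (fracCst s) (fracCst a0) (fracCst a1) (fracCst a2)
     (fracCst a3) (fracCst a4) (fracCst a5)).

Let r := inPhase (@rmap _) q1 p1 q2 p2.

Lemma rmap_birational i : birational (r i).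
Proof.
exists (inPhase (@rinv _) q1 p1 q2 p2 i) => j.
have rden0 := rden_fracVar i; split.
- rewrite -[X in ratValue _ _ X]fracVar_coords.
  rewrite -(inPhase (@rinvK _) q2 j rden0).
  apply: (rinv_eval (ratValue_partial_morphism (r i)));
    try exact: ratValue_cst; try exact: ratValue_var.
  exact: rden_rmap.
- set g := rinv _ _ _ _ _ _ _ _ _ _ _ _ _.
  rewrite -[X in ratValue _ _ X]fracVar_coords.
  rewrite -(inPhase (@rmapK _) q2 j rden0).
  apply: (rmap_eval (ratValue_partial_morphism g));
    try exact: ratValue_cst; try exact: ratValue_var.
  exact: rden_rinv.
Qed.

Lemma rmap_symplectic i : symplectic (r i).
Proof.
apply/matrixP => j k; rewrite congruence_omega.
have -> : omega (phaseField C) j k = (1%:M^T *m omega _ *m 1%:M) j k.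
  by rewrite trmx1 mul1mx mulmx1.
rewrite congruence_omega.
have E (l m : 'I_4) : phaseDeriv m (fracVar C l) = 1%:M l m.
  by rewrite phaseDeriv_var mxE.
rewrite -!E ![jacobian _ _ _]mxE.
refine (inPhase (@rmap_area _) q2 (phaseDeriv_derivation C j)
  (phaseDeriv_derivation C k) (rden_fracVar i) _).
by move=> c; rewrite !inE => /or4P[|||/or4P[|||/orP[]]] /eqP ->;
  split; exact: phaseDeriv_cst.
Qed.

Lemma H1_rewritten i (K := polyCst (H1factor t s a0 a1 a2 a3 a4 a5)^-1
    * H1rhs (polyVar C i_q1) (polyVar C i_p1) (polyVar C i_q2) (polyVar C i_p2)
        (polyCst t) (polyCst s) (polyCst a0) (polyCst a1) (polyCst a2)
        (polyCst a3) (polyCst a4) (polyCst a5)) :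
    H1factor t s a0 a1 a2 a3 a4 a5 != 0 ->
  regular (r i) (K%:F - (if i == 5%N :> nat then p1 else 0)).
Proof.
move=> c0; rewrite /K tofracM (H1rhs_morph (@tofrac (phasePoly C))).
have hS := regular_subring (r i).
have Sc c : regular (r i) (fracCst c) by exists (polyCst c); exact: psubstC.
have Sr j : regular (r i) (r i j) by exists (polyVar C j); exact: psubstX.
have c_inv : fracCst (H1factor t s a0 a1 a2 a3 a4 a5)^-1
    * inPhase (@H1factor _) = 1.
  rewrite -(H1factor_morph (@fracCst C)) -rmorphM mulVf //; exact: rmorph1.
rewrite -(scale_sub c_inv (erefl _)).
apply: (subringM hS); first exact: Sc.
apply: (H1rhs_regular hS _ (rden_fracVar i) Sr).
by move=> c; rewrite !inE => /or4P[|||/or4P[|||/orP[]]] /eqP ->; exact: Sc.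
Qed.

End Coefficients.
End Assembly.

(** * The theorem *)

(** The symmetry pi permutes the maps, exchanging r_4 and r_5. *)
Lemma rmap_swap (F : fieldType) (t s a0 a1 a2 a3 a4 a5 q1 p1 q2 p2 : F) (i : 'I_6) :
  exists2 i' : 'I_6, (i' == 5%N :> nat) = (i == 4%N :> nat)
    & rmap s t a0 a1 a2 a3 a5 a4 q1 p1 q2 p2 i'
      = rmap t s a0 a1 a2 a3 a4 a5 q1 p1 q2 p2 i.
Proof.
elim/forall_map: i;
  [exists (@Ordinal 6 0 isT)|exists (@Ordinal 6 1 isT)|exists (@Ordinal 6 2 isT)
  |exists (@Ordinal 6 3 isT)|exists (@Ordinal 6 5 isT)|exists (@Ordinal 6 4 isT)];
  by rewrite ?rmapE.
Qed.

Lemma H1factor_cancel (F : fieldType) (B : comNzRingType)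
    (f : {rmorphism F -> B}) t s a0 a1 a2 a3 a4 a5 x :
    H1factor t s a0 a1 a2 a3 a4 a5 != 0 ->
  H1factor (f t) (f s) (f a0) (f a1) (f a2) (f a3) (f a4) (f a5)
    * (f (H1factor t s a0 a1 a2 a3 a4 a5)^-1 * x) = x.
Proof.
by move=> c0; rewrite -H1factor_morph mulrA -rmorphM mulfV // rmorph1 mul1r.
Qed.

Section Time.
Variable C : fieldType.

Lemma timeVar_sub_neq0 (k l : 'I_2) : k != l -> timeVar C k - timeVar C l != 0.
Proof.
move=> kl; rewrite -tofracB tofrac_eq0.
apply/eqP => /(congr1 (mcoeff U_(k)%MM)); rewrite mcoeffB !mcoeffX eqxx.
rewrite mcoeff0 eq_mnm1 eq_sym (negbTE kl) subr0.
by move/eqP; rewrite oner_eq0.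
Qed.

Lemma timeVar_sub1_neq0 k : timeVar C k - 1 != 0.
Proof.
rewrite -tofrac1 -tofracB tofrac_eq0.
apply/eqP => /(congr1 (mcoeff U_(k)%MM)); rewrite mcoeffB !mcoeffX eqxx.
rewrite mcoeff1 mnm1_eq0 mcoeff0 subr0.
by move/eqP; rewrite oner_eq0.
Qed.

Lemma timeVar_neq0 k : timeVar C k != 0.
Proof.
rewrite tofrac_eq0; apply/eqP => /(congr1 (mcoeff U_(k)%MM)).
by rewrite mcoeffX eqxx mcoeff0 => /eqP; rewrite oner_eq0.
Qed.

Lemma H1factor_neq0 (k l : 'I_2) (a0 a1 a2 a3 a4 a5 : C) : k != l ->
    2 * a0 + a1 + a2 + a3 + a4 + a5 != 0 ->
  H1factor (timeVar C k) (timeVar C l) (timeCst a0) (timeCst a1) (timeCst a2)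
    (timeCst a3) (timeCst a4) (timeCst a5) != 0.
Proof.
move=> kl sum0; rewrite /H1factor.
have -> : 2 * timeCst a0 + timeCst a1 + timeCst a2 + timeCst a3 + timeCst a4
    + timeCst a5 = timeCst (2 * a0 + a1 + a2 + a3 + a4 + a5).
  by rewrite !(rmorphD, rmorphM, rmorph_nat).
rewrite !mulf_neq0 ?timeVar_sub_neq0 ?timeVar_sub1_neq0 ?timeVar_neq0 //.
by rewrite fmorph_eq0.
Qed.

End Time.

Section Flow.
Variables (C : fieldType) (a0 a1 a2 a3 a4 a5 : C).

Let r := atParams (@fracCst C) (@rmap _) a0 a1 a2 a3 a4 a5
  (fracVar C i_q1) (fracVar C i_p1) (fracVar C i_q2) (fracVar C i_p2).

(** The explicit time dependence of r_4 and r_5 is undone by a shift of q1. *)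
Lemma rmap_time (k : 'I_2) (i : 'I_6) (b : bool) j :
    b = (if i == 4%N :> nat then k == i_s
         else if i == 5%N :> nat then k == i_t else false) ->
  timeDeriv k (r i j) + b%:R * phaseDeriv i_q1 (r i j) = 0.
Proof.
move=> bE.
have dD := derivation_add b%:R (timeDeriv_derivation C k)
  (phaseDeriv_derivation C i_q1).
apply: (rmap_ker j dD (rden_fracVar C i)).
  have Da a : timeDeriv k (fracCst (timeCst a))
      + b%:R * phaseDeriv i_q1 (fracCst (timeCst a)) = 0 :> phaseField C.
    by rewrite timeDeriv_cst phaseDeriv_cst mulr0 addr0.
  have Dv l : l != i_q1 ->
      timeDeriv k (fracVar C l) + b%:R * phaseDeriv i_q1 (fracVar C l) = 0.
    by move=> ne; rewrite timeDeriv_var phaseDeriv_var (negbTE ne) mulr0 addr0.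
  move=> c; rewrite !inE => /or4P[|||/or4P[|||/or3P[]]] /eqP ->;
    [exact: Da|exact: Da|exact: Da|exact: Da|exact: Da|exact: Da
    |exact: Dv|exact: Dv|exact: Dv].
rewrite timeDeriv_var phaseDeriv_var eqxx mulr1 add0r.
rewrite !timeDeriv_time !phaseDeriv_cst mulr0 !addr0 bE.
by case: (_ == 4%N); [rewrite eq_sym | case: (_ == 5%N); rewrite ?[k == _]eq_sym].
Qed.

(** H2 and its new expressions are obtained from the statement about H1 with t and s, a4 and a5 exchanged. *)
Lemma painleve_hamiltonians :
    2 * a0 + a1 + a2 + a3 + a4 + a5 != 0 ->
  let q1 := polyVar C i_q1 in let p1 := polyVar C i_p1 in
  let q2 := polyVar C i_q2 in let p2 := polyVar C i_p2 in
  exists H1 H2 : phasePoly C,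
    [/\ atParams (@polyCst C) (@H1factor _) a0 a1 a2 a3 a4 a5 * H1
        = atParams (@polyCst C) (H1rhs q1 p1 q2 p2) a0 a1 a2 a3 a4 a5,
        atParams (@polyCst C) (piSubst (@H1factor _)) a0 a1 a2 a3 a4 a5 * H2
        = atParams (@polyCst C) (piSubst (H1rhs q1 p1 q2 p2))
            a0 a1 a2 a3 a4 a5
      & forall i : 'I_6,
          [/\ birational (r i), symplectic (r i)
            & polyHamiltonianIn H1 H2
                (if i == 5%N :> nat then fracVar C i_p1 else 0)
                (if i == 4%N :> nat then fracVar C i_p1 else 0) (r i)]].
Proof.
move=> sum0 q1 p1 q2 p2.
have c1_neq0 := H1factor_neq0 (isT : i_t != i_s) sum0.
have sum0' : 2 * a0 + a1 + a2 + a3 + a5 + a4 != 0 by rewrite addrAC.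
have c2_neq0 := H1factor_neq0 (isT : i_s != i_t) sum0'.
exists (polyCst (atParams id (@H1factor _) a0 a1 a2 a3 a4 a5)^-1
        * atParams (@polyCst C) (H1rhs q1 p1 q2 p2) a0 a1 a2 a3 a4 a5).
exists (polyCst (atParams id (piSubst (@H1factor _)) a0 a1 a2 a3 a4 a5)^-1
        * atParams (@polyCst C) (piSubst (H1rhs q1 p1 q2 p2)) a0 a1 a2 a3 a4 a5).
rewrite /piSubst /atParams; split.
- exact: (H1factor_cancel (@polyCst C) _ c1_neq0).
- exact: (H1factor_cancel (@polyCst C) _ c2_neq0).
move=> i; have sr : symplectic (r i) by exact: rmap_symplectic.
split=> //; first exact: rmap_birational.
have [K1 K1E] := H1_rewritten i c1_neq0.
have [i' i'E rE] := rmap_swap (fracCst (timeVar C i_t)) (fracCst (timeVar C i_s))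
  (fracCst (timeCst a0)) (fracCst (timeCst a1)) (fracCst (timeCst a2))
  (fracCst (timeCst a3)) (fracCst (timeCst a4)) (fracCst (timeCst a5))
  (fracVar C i_q1) (fracVar C i_p1) (fracVar C i_q2) (fracVar C i_p2) i.
have [K2 K2E] := H1_rewritten i' c2_neq0.
rewrite rE i'E in K2E.
exists K1, K2; split.
- exact: K1E.
- exact: K2E.
- apply: (hamiltonian_transport sr K1E) => j; apply: rmap_time.
  by move: (i); elim/forall_map.
- apply: (hamiltonian_transport sr K2E) => j; apply: rmap_time.
  by move: (i); elim/forall_map.
Qed.

End Flow.

Theorem mainTheorem4 (R : realType) (a0 a1 a2 a3 a4 a5 : R[i])
    (ha : 2 * a0 + a1 + a2 + a3 + a4 + a5 != 0) :
  let q1 := polyVar R[i] i_q1 in let p1 := polyVar R[i] i_p1 in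
  let q2 := polyVar R[i] i_q2 in let p2 := polyVar R[i] i_p2 in
  exists H1 H2 : phasePoly R[i],
    [/\ atParams (@polyCst R[i]) (@H1factor _) a0 a1 a2 a3 a4 a5 * H1
        = atParams (@polyCst R[i]) (H1rhs q1 p1 q2 p2) a0 a1 a2 a3 a4 a5,
        atParams (@polyCst R[i]) (piSubst (@H1factor _)) a0 a1 a2 a3 a4 a5 * H2
        = atParams (@polyCst R[i]) (piSubst (H1rhs q1 p1 q2 p2))
            a0 a1 a2 a3 a4 a5
      & forall i : 'I_6,
          let r := atParams (@fracCst R[i]) (@rmap _) a0 a1 a2 a3 a4 a5
                     (fracVar R[i] i_q1) (fracVar R[i] i_p1)
                     (fracVar R[i] i_q2) (fracVar R[i] i_p2) i in
          [/\ birational r, symplectic r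
            & polyHamiltonianIn H1 H2
                (if i == 5%N :> nat then fracVar R[i] i_p1 else 0)
                (if i == 4%N :> nat then fracVar R[i] i_p1 else 0) r]].
Proof. exact: painleve_hamiltonians ha. Qed.
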